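(* Let $n\ge 1$ and let $S\in\{\mathcal{CP}_n,\mathcal{OCP}_n,\mathcal{ORCP}_n\}$. Then $S$ is left abundant.
   Context: Let $[n]=\{1,2,\dots,n\}$ with the usual order, and let $\mathcal{P}_n$ be the semigroup of all partial maps $\alpha$ with domain $\operatorname{Dom}\alpha\subseteq[n]$ and image $\operatorname{Im}\alpha\subseteq[n]$ (including the empty map). Maps are written on the right and composed left to right: $x(\alpha\beta)=(x\alpha)\beta$, defined for those $x\in\operatorname{Dom}\alpha$ with $x\alpha\in\operatorname{Dom}\beta$. A map $\alpha\in\mathcal{P}_n$ is a contraction if $|x\alpha-y\alpha|\le|x-y|$ for all $x,y\in\operatorname{Dom}\alpha$; it is order preserving (resp. order reversing) if for all $x,y\in\operatorname{Dom}\alpha$, $x\le y$ implies $x\alpha\le y\alpha$ (resp. $x\alpha\ge y\alpha$). $\mathcal{CP}_n$ is the semigroup of all contractions in $\mathcal{P}_n$; $\mathcal{OCP}_n$ is the subsemigroup of order preserving contractions; $\mathcal{ORCP}_n$ is the subsemigroup of contractions that are order preserving or order reversing. For a semigroup $S$ (with $S^1$ denoting $S$ with an identity adjoined if necessary), $a\,\mathcal{L}^*\,b$ iff for all $x,y\in S^1$, $ax=ay\Leftrightarrow bx=by$. The semigroup $S$ is called left abundant if every $\mathcal{L}^*$-class of $S$ contains an idempotent. *)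

(* Defs.v *)
From HB Require Import structures.
From mathcomp Require Import all_boot ssralg ssrint.

Set Implicit Arguments.
Unset Strict Implicit.
Unset Printing Implicit Defensive.

Local Open Scope nat_scope.

(** * The semigroup S^1, the relation L* and left abundance *)

Section LeftAbundant.
Local Open Scope group_scope.

Definition has_identity (S : semigroupType) : Prop :=
  exists e : S, left_id e *%g /\ right_id e *%g.

(* S^1 lives in [option S], [None] being the adjoined identity; [None] is an
   element of S^1 only when S has no identity of its own. *)
Definition in_S1 (S : semigroupType) (x : option S) : Prop :=
  x = None -> ~ has_identity S.

Definition mulS1 (S : semigroupType) (x y : option S) : option S :=
  match x, y with
  | None, _ => y
  | _, None => x
  | Some a, Some b => Some (a * b)
  end.

Definition Lstar (S : semigroupType) (a b : S) : Prop :=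
  forall x y : option S, in_S1 x -> in_S1 y ->
    (mulS1 (Some a) x = mulS1 (Some a) y <->
     mulS1 (Some b) x = mulS1 (Some b) y).

Definition left_abundant (S : semigroupType) : Prop :=
  forall a : S, exists e : S, e * e = e /\ Lstar a e.

End LeftAbundant.

(** * Partial maps of [n] *)

(* The chain 1 < 2 < ... < n is represented by 'I_n = {0 < ... < n-1}; the
   shift by one changes neither the order nor the distances.  [a x = None]
   means that x is outside the domain of a. *)
Definition ptrans (n : nat) : Type := {ffun 'I_n -> option 'I_n}.

HB.instance Definition _ n := Choice.copy (ptrans n) {ffun 'I_n -> option 'I_n}.

(* Left-to-right composition: x (a b) = (x a) b. *)
Definition ptrans_mul n (a b : ptrans n) : ptrans n :=
  [ffun x => obind b (a x)].

Lemma ptrans_mulE n (a b : ptrans n) x : ptrans_mul a b x = obind b (a x).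
Proof. by rewrite ffunE. Qed.

Lemma ptrans_mulA n : associative (@ptrans_mul n).
Proof.
move=> a b c; apply/ffunP => x.
by rewrite !ptrans_mulE; case: (a x) => //= y; rewrite ptrans_mulE.
Qed.

HB.instance Definition _ n := isSemigroup.Build (ptrans n) (@ptrans_mulA n).

Lemma ptrans_mulP n (a b : ptrans n) x w :
  (a * b)%g x = Some w -> exists2 u, a x = Some u & b u = Some w.
Proof. by rewrite ptrans_mulE; case: (a x) => //= u; exists u. Qed.

(* [domrel R a]: all x, y in Dom a satisfy R x y (x a) (y a). *)
Definition domrel n (R : 'I_n -> 'I_n -> 'I_n -> 'I_n -> bool) (a : ptrans n) :
    bool :=
  [forall x, forall y, forall u, forall v,
     (a x == Some u) && (a y == Some v) ==> R x y u v].

Lemma domrelP n (R : 'I_n -> 'I_n -> 'I_n -> 'I_n -> bool) (a : ptrans n) :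
  reflect (forall x y u v, a x = Some u -> a y = Some v -> R x y u v)
          (domrel R a).
Proof.
apply: (iffP forallP) => [H x y u v ax ay | H x].
  move/forallP: (H x) => /(_ y)/forallP/(_ u)/forallP/(_ v).
  by rewrite ax ay !eqxx.
apply/forallP => y; apply/forallP => u; apply/forallP => v.
by apply/implyP => /andP[/eqP ax /eqP ay]; apply: H.
Qed.

Definition contraction n : pred (ptrans n) :=
  domrel (fun x y u v => `|u - v| <= `|x - y|).

Definition order_preserving n : pred (ptrans n) :=
  domrel (fun x y u v => (x <= y) ==> (u <= v)).

Definition order_reversing n : pred (ptrans n) :=
  domrel (fun x y u v => (x <= y) ==> (v <= u)).

Definition CP_pred n : {pred ptrans n} := fun a => contraction a.

Definition OCP_pred n : {pred ptrans n} :=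
  fun a => contraction a && order_preserving a.

Definition ORCP_pred n : {pred ptrans n} :=
  fun a => contraction a && (order_preserving a || order_reversing a).

Lemma contractionM n (a b : ptrans n) :
  contraction a -> contraction b -> contraction (a * b)%g.
Proof.
move=> /domrelP ca /domrelP cb; apply/domrelP => x y u v.
move=> /ptrans_mulP[s ax bs] /ptrans_mulP[t ay bt].
exact: leq_trans (cb _ _ _ _ bs bt) (ca _ _ _ _ ax ay).
Qed.

Lemma order_ppM n (a b : ptrans n) :
  order_preserving a -> order_preserving b -> order_preserving (a * b)%g.
Proof.
move=> /domrelP oa /domrelP ob; apply/domrelP => x y u v.
move=> /ptrans_mulP[s ax bs] /ptrans_mulP[t ay bt]; apply/implyP => xy.
by apply: (implyP (ob _ _ _ _ bs bt)); apply: (implyP (oa _ _ _ _ ax ay)).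
Qed.

Lemma order_prM n (a b : ptrans n) :
  order_preserving a -> order_reversing b -> order_reversing (a * b)%g.
Proof.
move=> /domrelP oa /domrelP ob; apply/domrelP => x y u v.
move=> /ptrans_mulP[s ax bs] /ptrans_mulP[t ay bt]; apply/implyP => xy.
by apply: (implyP (ob _ _ _ _ bs bt)); apply: (implyP (oa _ _ _ _ ax ay)).
Qed.

Lemma order_rpM n (a b : ptrans n) :
  order_reversing a -> order_preserving b -> order_reversing (a * b)%g.
Proof.
move=> /domrelP oa /domrelP ob; apply/domrelP => x y u v.
move=> /ptrans_mulP[s ax bs] /ptrans_mulP[t ay bt]; apply/implyP => xy.
by apply: (implyP (ob _ _ _ _ bt bs)); apply: (implyP (oa _ _ _ _ ax ay)).
Qed.

Lemma order_rrM n (a b : ptrans n) :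
  order_reversing a -> order_reversing b -> order_preserving (a * b)%g.
Proof.
move=> /domrelP oa /domrelP ob; apply/domrelP => x y u v.
move=> /ptrans_mulP[s ax bs] /ptrans_mulP[t ay bt]; apply/implyP => xy.
by apply: (implyP (ob _ _ _ _ bt bs)); apply: (implyP (oa _ _ _ _ ax ay)).
Qed.

Lemma CP_mulg_closed n : mulg_closed (@CP_pred n).
Proof. by move=> a b; apply: contractionM. Qed.

Lemma OCP_mulg_closed n : mulg_closed (@OCP_pred n).
Proof.
move=> a b /andP[ca oa] /andP[cb ob].
by apply/andP; split; [apply: contractionM | apply: order_ppM].
Qed.

Lemma ORCP_mulg_closed n : mulg_closed (@ORCP_pred n).
Proof.
move=> a b /andP[ca oa] /andP[cb ob].
apply/andP; split; first exact: contractionM.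
apply/orP; case/orP: oa => oa; case/orP: ob => ob.
- by left; apply: order_ppM.
- by right; apply: order_prM.
- by right; apply: order_rpM.
- by left; apply: order_rrM.
Qed.

(** * The semigroups CP_n, OCP_n and ORCP_n *)

Record CP n := MkCP { CP_val :> ptrans n; CP_valP : CP_val \in @CP_pred n }.
HB.instance Definition _ n := [isSub for @CP_val n].
HB.instance Definition _ n := [Choice of CP n by <:].
HB.instance Definition _ n :=
  SubChoice_isSubSemigroup.Build (ptrans n) (@CP_pred n) (CP n)
    (@CP_mulg_closed n).

Record OCP n := MkOCP { OCP_val :> ptrans n; OCP_valP : OCP_val \in @OCP_pred n }.
HB.instance Definition _ n := [isSub for @OCP_val n].
HB.instance Definition _ n := [Choice of OCP n by <:].
HB.instance Definition _ n :=
  SubChoice_isSubSemigroup.Build (ptrans n) (@OCP_pred n) (OCP n)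
    (@OCP_mulg_closed n).

Record ORCP n :=
  MkORCP { ORCP_val :> ptrans n; ORCP_valP : ORCP_val \in @ORCP_pred n }.
HB.instance Definition _ n := [isSub for @ORCP_val n].
HB.instance Definition _ n := [Choice of ORCP n by <:].
HB.instance Definition _ n :=
  SubChoice_isSubSemigroup.Build (ptrans n) (@ORCP_pred n) (ORCP n)
    (@ORCP_mulg_closed n).

(* Main.v *)
Require Import Defs.
From mathcomp Require Import all_boot.

(** The value of [a * x] depends only on the restriction of [x] to [Im a], and
    determines it.  Hence [a] is L*-related to the partial identity on [Im a],
    an idempotent lying in each of the three semigroups. *)

Definition ptrans_im n (a : ptrans n) : {set 'I_n} :=
  [set u | [exists x, a x == Some u]].

Definition pid n (A : {set 'I_n}) : ptrans n :=
  [ffun x => if x \in A then Some x else None].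

Lemma pidP n (A : {set 'I_n}) x u : pid n A x = Some u -> x = u /\ u \in A.
Proof. by rewrite ffunE; case: ifP => // xA [<-]. Qed.

Lemma pid_idem n (A : {set 'I_n}) : (pid n A * pid n A)%g = pid n A.
Proof.
by apply/ffunP => x; rewrite ptrans_mulE ffunE; case: ifP => //= xA; rewrite ffunE xA.
Qed.

Lemma mulg_pid1 n (a : ptrans n) : (a * pid n setT)%g = a.
Proof.
by apply/ffunP => x; rewrite ptrans_mulE; case: (a x) => //= u; rewrite ffunE inE.
Qed.

Lemma ptrans_im_pid n (A : {set 'I_n}) : ptrans_im n (pid n A) = A.
Proof.
apply/setP => u; rewrite inE; apply/existsP/idP => [[x /eqP/pidP[]] // | uA].
by exists u; rewrite ffunE uA.
Qed.

(** Evaluating at a preimage of [u] recovers [p u = q u]; off the domain of [a] both products are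
    undefined. *)
Lemma eq_mulg_im n (a p q : ptrans n) :
  (a * p = a * q)%g <-> {in ptrans_im n a, p =1 q}.
Proof.
split=> [/ffunP eq_apq u | eq_pq].
  rewrite inE => /existsP[x /eqP ax].
  by have := eq_apq x; rewrite !ptrans_mulE ax.
apply/ffunP => x; rewrite !ptrans_mulE; case ax: (a x) => [u|] //=.
by apply: eq_pq; rewrite inE; apply/existsP; exists x; rewrite ax.
Qed.

(** This treats the three semigroups uniformly, [f] being the inclusion: equalities in [S] are
    tested among partial maps, and the last premise supplies the idempotents. *)
Lemma left_abundant_pid n (S : semigroupType) (f : S -> ptrans n) :
    injective f -> {morph f : x y / (x * y)%g} ->
    (forall A, exists e, f e = pid n A) ->
  left_abundant S.
Proof.
move=> f_inj fM f_pid a; have [e fe] := f_pid (ptrans_im n (f a)).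
(* The adjoined identity is sent to the full identity map, so products in [S^1] also become products
   of partial maps. *)
pose f1 x := if x is Some s then f s else pid n setT.
have f1M b x y : mulS1 (Some b) x = mulS1 (Some b) y <->
                 {in ptrans_im n (f b), f1 x =1 f1 y}.
  (* With left factor [Some b] the product is never [None], so [f] applies to it. *)
  have f1E z : exists2 s, mulS1 (Some b) z = Some s & f s = (f b * f1 z)%g.
    case: z => [s|] /=; first by exists (b * s)%g.
    by exists b; rewrite ?mulg_pid1.
  have [[s -> fs] [t -> ft]] := (f1E x, f1E y).
  split=> [[st] | /eq_mulg_im]; first by apply/eq_mulg_im; rewrite -fs -ft st.
  by rewrite -fs -ft => /f_inj->.
exists e; split; first by apply: f_inj; rewrite fM fe pid_idem.
(* [f e] and [f a] have the same image, so [f1M] yields one and the same agreement condition for [a]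
   and [e]. *)
move=> x y _ _; have := f1M e x y; rewrite fe ptrans_im_pid => eP.
by split=> [/f1M/eP | /eP/f1M].
Qed.

Lemma contraction_pid n (A : {set 'I_n}) : contraction (pid n A).
Proof. by apply/domrelP => x y u v /pidP[-> _] /pidP[-> _]. Qed.

Lemma order_preserving_pid n (A : {set 'I_n}) : order_preserving (pid n A).
Proof.
by apply/domrelP => x y u v /pidP[-> _] /pidP[-> _]; apply/implyP.
Qed.

Theorem lemma2p5 (n : nat) (hn : (1 <= n)%N) :
  left_abundant (CP n) /\ left_abundant (OCP n) /\ left_abundant (ORCP n).
Proof.
have cA := contraction_pid n; have oA := order_preserving_pid n.
split; [|split].
- apply: (@left_abundant_pid n _ (@CP_val n)) => [||A] //; first exact: val_inj.
  by exists (MkCP (cA A)).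
- have ocA A : pid n A \in @OCP_pred n by apply/andP; split.
  apply: (@left_abundant_pid n _ (@OCP_val n)) => [||A] //; first exact: val_inj.
  by exists (MkOCP (ocA A)).
(* Partial identities satisfy the order preserving alternative. *)
- have orcA A : pid n A \in @ORCP_pred n by apply/andP; split; rewrite ?oA.
  apply: (@left_abundant_pid n _ (@ORCP_val n)) => [||A] //; first exact: val_inj.
  by exists (MkORCP (orcA A)).
Qed.
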